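(* Any deterministic algorithm for triangle membership in the CONGEST$(1)$ model requires $\Omega(\log^* n)$ rounds, even for graphs of maximum degree $2$. That is, there exist constants $c>0$ and $n_0$ such that for every $n\ge n_0$, every deterministic algorithm in the CONGEST$(1)$ model that solves the triangle membership problem on all $n$-node graphs of maximum degree at most $2$ uses at least $c\log^* n$ rounds.
   Context: CONGEST$(B)$ model (with $KT_1$ knowledge): the network is a simple undirected graph on $n$ nodes, each node having a unique ID in $[N]=\{1,\dots,N\}$, where $N\ge n$ is some polynomial in $n$. Initially each node knows its own ID and the IDs of its neighbors (and the global parameters such as $n$, $N$), and nothing else about the graph. Computation proceeds in synchronous rounds; in each round each node sends a message of exactly $B$ bits to each of its neighbors (possibly different messages to different neighbors). The message sent in a round is a function of the initial knowledge of the node and the messages received in previous rounds; local computation is unbounded. After the last round each node produces an output determined by its initial knowledge and all messages it received. An algorithm solves a problem on a class of graphs if it is correct for every graph in the class and every assignment of distinct IDs from $[N]$. CONGEST$(1)$ is the case $B=1$. Triangle membership problem: each node must output whether it is contained in a triangle of the graph. $\log^* n$ is the iterated logarithm: the number of times $\log_2$ must be applied to $n$ until the result is at most $1$. *)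

(* Defs.v *)
From HB Require Import structures.
From mathcomp Require Import all_boot all_order all_algebra.
From mathcomp Require Import reals exp ring lra.

Set Implicit Arguments.
Unset Strict Implicit.
Unset Printing Implicit Defensive.

Import Order.TTheory GRing.Theory Num.Theory.
Local Open Scope ring_scope.

Definition log2 (R : realType) (x : R) : R := ln x / ln 2.

Lemma log2_le_sub1 (R : realType) (x : R) : 2 <= x -> log2 x <= x - 1.
Proof.
move=> x2; have x0 : 0 < x by lra.
have ln2 : 0 < ln (2 : R) by apply: ln_gt0; lra.
have half : 1 / 2 <= ln (2 : R).
  have := @le_ln1Dx R (- (1 / 2)).
  have -> : 1 + - (1 / 2) = 2^-1 :> R by field.
  by rewrite lnV ?posrE // => /(_ ltac:(lra)); lra.
have lnx : ln x <= ln 2 + (x / 2 - 1).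
  have -> : ln x = ln 2 + ln (1 + (x / 2 - 1)).
    by rewrite -lnM ?posrE; [congr ln; field|lra|lra].
  by rewrite lerD2l; apply: le_ln1Dx; lra.
by rewrite /log2 ler_pdivrMr //; nra.
Qed.

Lemma log_star_ex (R : realType) (x : R) : exists k, iter k (@log2 R) x <= 1.
Proof.
have H : forall m y, y <= m.+1%:R -> exists k, iter k (@log2 R) y <= 1.
  elim=> [|m IH] y hy; first by exists 0%N.
  have [y2|y2] := ltP y 2.
    have [y1|y1] := leP y 1; first by exists 0%N.
    exists 1%N => /=; rewrite /log2 ler_pdivrMr ?ln_gt0 ?ltr1n // mul1r.
    by rewrite ler_ln ?posrE ?ltr0n ?ltW // (lt_trans _ y1).
  have /IH [k hk] : log2 y <= m.+1%:R.
    apply: le_trans (log2_le_sub1 y2) _.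
    by rewrite lerBlDr natr1.
  by exists k.+1; rewrite iterSr.
apply: (H (Num.truncn `|x|) x).
by apply: le_trans (ler_norm _) _; apply/ltW/truncnS_gt.
Qed.

(* The least number of applications of log2 that brings x down to at most 1.
   The junk value of ln on nonpositive reals is never used: for x > 1, every
   iterate before that point exceeds 1. *)
Definition log_star (R : realType) (x : R) : nat := ex_minn (log_star_ex x).

Local Open Scope nat_scope.

(* "N is polynomial in n" in the sense N(n) = poly(n); every polynomial
   satisfies this. *)
Definition poly_bounded (N : nat -> nat) : Prop :=
  exists C k, forall n, N n <= C * n ^ k + C.

Definition simple_graph (V : finType) (e : rel V) : Prop :=
  symmetric e /\ irreflexive e.

Definition degree (V : finType) (e : rel V) (v : V) : nat :=
  #|[set u | e v u]|.

Definition in_triangle (V : finType) (e : rel V) (v : V) : bool :=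
  [exists u, exists w, [&& e v u, e v w & e u w]].

(* The messages received in one round, indexed by the ID of the sender; None
   at IDs that are not those of neighbors. The ID space [N] is 'I_N, i.e.
   IDs are numbered from 0. *)
Definition inbox (N B : nat) : Type := {ffun 'I_N -> option (B.-tuple bool)}.

(* A node's state is its own ID, the set of its neighbors' IDs, and the inboxes
   of all previous rounds in chronological order (so that the index of the
   current round is the length of that list). [send] also takes the ID of the
   neighbor to which the message is addressed. *)
Record congest_algorithm (N B : nat) (O : Type) := CongestAlgorithm {
  rounds : nat;
  send : 'I_N -> {set 'I_N} -> seq (inbox N B) -> 'I_N -> B.-tuple bool;
  output : 'I_N -> {set 'I_N} -> seq (inbox N B) -> O
}.

Definition nbr_ids (V : finType) (e : rel V) (N : nat) (id : V -> 'I_N)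
  (v : V) : {set 'I_N} := [set id u | u in [set u | e v u]].

Fixpoint history (V : finType) (e : rel V) (N B : nat) (O : Type)
    (A : congest_algorithm N B O) (id : V -> 'I_N) (r : nat) (v : V)
    : seq (inbox N B) :=
  if r is r'.+1 then
    rcons (history e A id r' v)
      [ffun x => if [pick u | e v u && (id u == x)] is Some u then
                   Some (send A (id u) (nbr_ids e id u) (history e A id r' u)
                           (id v))
                 else None]
  else [::].

Definition run (V : finType) (e : rel V) (N B : nat) (O : Type)
    (A : congest_algorithm N B O) (id : V -> 'I_N) (v : V) : O :=
  output A (id v) (nbr_ids e id v) (history e A id (rounds A) v).

Definition solves_triangle_membership (n D N B : nat)
    (A : congest_algorithm N B bool) : Prop :=
  forall (V : finType) (e : rel V) (id : V -> 'I_N),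
    #|V| = n -> simple_graph e -> (forall v, degree e v <= D) ->
    injective id ->
    forall v, run e A id v = in_triangle e v.

(* Main.v *)
(* Split the nodes into three parts and colour each triple (a, b, c) by the
   transcript of the algorithm on the triangle abc (plus isolated nodes): with
   r rounds there are at most 2^(9r) colours. If the parts are polynomially
   large in the number of colours, iterated pigeonhole yields pairs {a, a'},
   {b, b'}, {c, c'} whose eight triangles all have the same transcript. In the
   hexagon a b c a' b' c', each node has the same neighbours as in one of these
   triangles, so by induction on the rounds it receives the same messages and
   wrongly answers that it lies in a triangle. Hence n < 2^O(r), a bound far
   stronger than the one in log* n. *)
Require Import Defs.
From mathcomp Require Import all_boot all_order all_algebra.
From mathcomp Require Import reals exp.
From mathcomp Require Import boolp zify.
Import Order.TTheory GRing.Theory Num.Theory.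
Local Open Scope ring_scope.

Set Implicit Arguments.
Unset Strict Implicit.
Unset Printing Implicit Defensive.

(** * Histories in a graph that locally looks like other graphs *)

Definition message (V : finType) (N B : nat) (O : Type)
    (A : congest_algorithm N B O) (id : V -> 'I_N) (e : rel V)
    (t : nat) (u v : V) : B.-tuple bool :=
  send A (id u) (nbr_ids e id u) (history e A id t u) (id v).

Lemma eq_nbr_ids (V : finType) (N : nat) (id : V -> 'I_N) (e e' : rel V) v :
  e v =1 e' v -> nbr_ids e id v = nbr_ids e' id v.
Proof. by move=> ee'; rewrite /nbr_ids; under eq_finset do rewrite ee'. Qed.

(* Each x i may be fooled by a different graph f i: only the initial
   knowledge and the messages across the edges of e have to agree. *)
Lemma history_fooled (V : finType) (N B : nat) (O : Type)
    (A : congest_algorithm N B O) (id : V -> 'I_N) (J : Type) (x : J -> V)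
    (e : rel V) (f : J -> rel V) (r : nat) :
  (forall i, e (x i) =1 f i (x i)) ->
  (forall i u, e (x i) u -> exists2 j, u = x j &
     forall t, (t < r)%N ->
       message A id (f j) t u (x i) = message A id (f i) t u (x i)) ->
  forall t i, (t <= r)%N -> history e A id t (x i) = history (f i) A id t (x i).
Proof.
move=> ef emsg; elim=> [//|t IHt] i ltr /=.
rewrite IHt 1?ltnW //; congr rcons; apply/ffunP=> z; rewrite !ffunE.
under eq_pick do rewrite ef.
case: pickP => [u /andP[fiu _]|//]; congr Some.
have eiu : e (x i) u by rewrite ef.
have [j uE /(_ t ltr) msg] := emsg i u eiu.
rewrite -[RHS]msg /message uE IHt 1?ltnW //.
by rewrite (eq_nbr_ids id (ef j)).
Qed.

(** * Cycles indexed by ['Z_m], in particular triangle and hexagon *)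

Definition cycle_graph (V : finType) (m : nat) (w : 'Z_m -> V) : rel V :=
  fun u v => [exists i, (u == w i) && ((v == w (i + 1)) || (v == w (i - 1)))].

Lemma cycle_graphE (V : finType) (m : nat) (w : 'Z_m -> V) i v :
  injective w ->
  cycle_graph w (w i) v = (v == w (i + 1)) || (v == w (i - 1)).
Proof.
move=> winj; apply/existsP/idP => [[j /andP[/eqP/winj <-]] //|wi].
by exists i; rewrite eqxx.
Qed.

Lemma cycle_graph_vertex (V : finType) (m : nat) (w : 'Z_m -> V) u v :
  cycle_graph w u v -> exists i, u = w i.
Proof. by case/existsP => i /andP[/eqP-> _]; exists i. Qed.

(** No bound on [m] appears: ['Z_m] always has at least two elements, so [1 != 0] and there are no
    loops. *)
Lemma cycle_graph_simple (V : finType) (m : nat) (w : 'Z_m -> V) :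
  injective w -> simple_graph (cycle_graph w).
Proof.
move=> winj.
have half u v : cycle_graph w u v -> cycle_graph w v u.
  case/existsP=> i /andP[/eqP-> /orP[]/eqP->]; rewrite cycle_graphE //.
    by rewrite addrK eqxx orbT.
  by rewrite subrK eqxx.
split=> [u v|u]; first by apply/idP/idP; apply: half.
case uu: (cycle_graph w u u) => //; have [i uE] := cycle_graph_vertex uu.
rewrite -uu uE cycle_graphE //.
rewrite !(inj_eq winj) eq_sym -subr_eq0 addrAC subrr add0r oner_eq0 /=.
by apply/negbTE; rewrite -subr_eq0 opprB addrC subrK oner_eq0.
Qed.

Lemma cycle_graph_degree (V : finType) (m : nat) (w : 'Z_m -> V) v :
  injective w -> (degree (cycle_graph w) v <= 2)%N.
Proof.
move=> winj; rewrite /degree.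
case: (pickP (cycle_graph w v)) => [u /cycle_graph_vertex[i ->]|e0]; last first.
  by under eq_finset do rewrite e0; rewrite cards0.
apply: (@leq_trans #|[set w (i + 1); w (i - 1)]|); last first.
  by rewrite cards2; case: (_ != _).
by apply/subset_leq_card/subsetP => z; rewrite !inE cycle_graphE.
Qed.

Lemma cycle3_in_triangle (V : finType) (w : 'Z_3 -> V) i :
  injective w -> in_triangle (cycle_graph w) (w i).
Proof.
move=> winj; apply/existsP; exists (w (i + 1)); apply/existsP; exists (w (i - 1)).
rewrite !cycle_graphE // !eqxx orbT /= !(inj_eq winj).
by case: i => [[|[|[|]]]].
Qed.

Lemma cycle6_triangle_free (V : finType) (w : 'Z_6 -> V) i :
  injective w -> ~~ in_triangle (cycle_graph w) (w i).
Proof.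
move=> winj; apply/negP => /existsP[u /existsP[v /and3P[]]].
rewrite !cycle_graphE // => /orP[]/eqP-> /orP[]/eqP->.
all: rewrite cycle_graphE // !(inj_eq winj).
all: by case: i => [[|[|[|[|[|[|]]]]]]].
Qed.

(** * The hexagon as a double cover of the triangle *)

Definition residue3 (k : 'Z_6) : 'Z_3 := inZp k.

(* The triangle of Z/3 placed on the path k-1, k, k+1 of the hexagon, which is
   what the node k believes to live in. *)
Definition lift6 (k : 'Z_6) (i : 'Z_3) : 'Z_6 :=
  if i == residue3 k then k else if i == residue3 k + 1 then k + 1 else k - 1.

Lemma residue3D1 k : residue3 (k + 1) = residue3 k + 1.
Proof. by apply/val_inj; case: k => [[|[|[|[|[|[|]]]]]]]. Qed.

Lemma residue3B1 k : residue3 (k - 1) = residue3 k - 1.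
Proof. by apply/val_inj; case: k => [[|[|[|[|[|[|]]]]]]]. Qed.

Lemma residue3_half_inj (k l : 'Z_6) :
  residue3 k = residue3 l -> (3 <= k)%N = (3 <= l)%N -> k = l.
Proof.
move=> /(congr1 val) kl kl3; apply/val_inj.
have k6 : (k < 6)%N := ltn_ord k; have l6 : (l < 6)%N := ltn_ord l.
have {}kl : (k %% 3 = l %% 3)%N := kl.
move: kl3 => /=; lia.
Qed.

Lemma lift6_residue k : lift6 k (residue3 k) = k.
Proof. by rewrite /lift6 eqxx. Qed.

Lemma lift6D1 k : lift6 k (residue3 k + 1) = k + 1.
Proof.
by rewrite /lift6 -subr_eq0 addrAC subrr add0r oner_eq0 eqxx.
Qed.

Lemma lift6B1 k : lift6 k (residue3 k - 1) = k - 1.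
Proof. by apply/val_inj; case: k => [[|[|[|[|[|[|]]]]]]]. Qed.

Lemma lift6K k : cancel (lift6 k) residue3.
Proof.
move=> i; apply/val_inj.
by case: k => [[|[|[|[|[|[|]]]]]]] // kP; case: i => [[|[|[|]]]].
Qed.

(** There is one entry per round and ordered pair of positions, hence 9 bits per round when
    [B = 1]. *)
Definition transcript (V : finType) (N B : nat) (O : Type)
    (A : congest_algorithm N B O) (id : V -> 'I_N) (w : 'Z_3 -> V) :
    {ffun 'I_(rounds A) * 'Z_3 * 'Z_3 -> B.-tuple bool} :=
  [ffun q : 'I_(rounds A) * 'Z_3 * 'Z_3 =>
     message A id (cycle_graph w) q.1.1 (w q.1.2) (w q.2)].

Lemma transcript_not_constant (V : finType) (n N B : nat)
    (A : congest_algorithm N B bool) (id : V -> 'I_N)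
    (y : 'Z_3 -> bool -> V) c :
  #|V| = n -> injective id -> solves_triangle_membership n 2 A ->
  (forall i j s s', y i s = y j s' -> i = j /\ s = s') ->
  ~ (forall s : 'Z_3 -> bool, transcript A id (fun i => y i (s i)) = c).
Proof.
move=> Vn idinj Asolves yinj cst.
(* Position i occurs at k = i with the choice [false] and at k = i + 3 with [true]. So three
   consecutive nodes have distinct positions and span one of the eight triangles. *)
pose x (k : 'Z_6) := y (residue3 k) (3 <= k)%N.
have xinj : injective x.
  by move=> k l /yinj[]; apply: residue3_half_inj.
have tinj k : injective (x \o lift6 k).
  by apply: inj_comp xinj _; apply: can_inj (lift6K k).
have tc k : transcript A id (x \o lift6 k) = c.
  rewrite -(cst (fun i => (3 <= lift6 k i)%N)); congr transcript.
  by apply: funext => i; rewrite /x /= lift6K.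
have xE k : x k = (x \o lift6 k) (residue3 k) by rewrite /= lift6_residue.
have nbrE k : cycle_graph x (x k) =1 cycle_graph (x \o lift6 k) (x k).
  move=> u; rewrite cycle_graphE // [in RHS]xE cycle_graphE //=.
  by rewrite lift6D1 lift6B1.
(* The two premises on [lift6] say that the triangles around k and l both contain both nodes; both
   triangles have transcript [c]. *)
have msgE k l t : (t < rounds A)%N ->
    lift6 k (residue3 l) = l -> lift6 l (residue3 k) = k ->
    message A id (cycle_graph (x \o lift6 l)) t (x l) (x k) =
    message A id (cycle_graph (x \o lift6 k)) t (x l) (x k).
  move=> tr kl lk; have := tc k; rewrite -(tc l).
  move/ffunP/(_ (Ordinal tr, residue3 l, residue3 k)); rewrite !ffunE /=.
  by rewrite kl lk !lift6_residue.
have hist : history (cycle_graph x) A id (rounds A) (x 0) =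
            history (cycle_graph (x \o lift6 0)) A id (rounds A) (x 0).
  apply: (@history_fooled _ _ _ _ _ _ _ x _
    (fun k => cycle_graph (x \o lift6 k)) (rounds A)) => //.
  move=> k u; rewrite cycle_graphE // => /orP[]/eqP->; eexists => // t tr.
    apply: msgE => //; first by rewrite residue3D1 lift6D1.
    by rewrite -[in residue3 k](addrK 1 k) residue3B1 lift6B1 addrK.
  apply: msgE => //; first by rewrite residue3B1 lift6B1.
  by rewrite -[in residue3 k](subrK 1 k) residue3D1 lift6D1 subrK.
have solved m (w : 'Z_m -> V) v : injective w ->
    run (cycle_graph w) A id v = in_triangle (cycle_graph w) v.
  move=> winj; apply: Asolves => //; first exact: cycle_graph_simple.
  by move=> u; apply: cycle_graph_degree.
have := cycle6_triangle_free 0 xinj; rewrite -solved //.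
rewrite /run hist (eq_nbr_ids id (nbrE 0)) -/(run _ A id _) solved //.
by rewrite xE cycle3_in_triangle.
Qed.

Local Open Scope nat_scope.

(** * Iterated pigeonhole and the resulting bound on the number of nodes *)

Lemma pigeonhole (T C : finType) (F : T -> C) :
  #|C| < #|T| -> exists p : T * T, (p.1 != p.2) && (F p.1 == F p.2).
Proof.
move=> ltCT; have /injectivePn[u [v uv Fuv]] : ~~ injectiveb F.
  by apply: contraL ltCT => /injectiveP/leq_card; rewrite -leqNgt.
by exists (u, v); rewrite /= uv Fuv eqxx.
Qed.

(** For fixed b and d, two elements of [T0] share a colour. Colour b by that colour together with
    the chosen pair: two b's then agree on both. Repeat once more for d. The size hypotheses count
    these enriched colours. *)
Lemma monochromatic_box (T0 T1 T2 C : finType) (F : T0 -> T1 -> T2 -> C) :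
  #|C| < #|T0| -> #|C| * #|T0| ^ 2 < #|T1| ->
  #|C| * #|T0| ^ 2 * #|T1| ^ 2 < #|T2| ->
  exists (a : bool -> T0) (b : bool -> T1) (d : bool -> T2) (c : C),
    [/\ injective a, injective b, injective d &
        forall i j k, F (a i) (b j) (d k) = c].
Proof.
move=> lt0 lt1 lt2.
have [p0 p0P] := choice (fun q => pigeonhole (fun a => F a q.1 q.2) lt0).
pose F1 d b := (F (p0 (b, d)).1 b d, p0 (b, d)).
have cF1 : #|{: C * (T0 * T0)}| < #|T1| by rewrite !card_prod mulnn.
have [p1 p1P] := choice (fun d => pigeonhole (F1 d) cF1).
pose F2 d := (F1 d (p1 d).1, p1 d).
have cF2 : #|{: C * (T0 * T0) * (T1 * T1)}| < #|T2|.
  by rewrite !card_prod !mulnn.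
have [[d d'] /= /andP[dd' /eqP[Fd p0d p1d]]] := pigeonhole F2 cF2.
have /andP[bb _] := p1P d.
have /andP[aa _] := p0P ((p1 d).1, d).
pose pick T (p : T * T) i := if i then p.1 else p.2.
have pick_inj (T : eqType) (p : T * T) : p.1 != p.2 -> injective (pick T p).
  by move=> /eqP pp [] [] //= /esym.
exists (pick _ (p0 ((p1 d).1, d))), (pick _ (p1 d)), (pick _ (d, d')).
exists (F (p0 ((p1 d).1, d)).1 (p1 d).1 d); split; try exact: pick_inj.
have Fa b e : F (p0 (b, e)).2 b e = F (p0 (b, e)).1 b e.
  by have /andP[_ /eqP] := p0P (b, e).
have Fa1 i b e : F (pick _ (p0 (b, e)) i) b e = F (p0 (b, e)).1 b e.
  by case: i => /=.
have Fab i j e : F (pick _ (p0 ((p1 e).1, e)) i) (pick _ (p1 e) j) e =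
    F (p0 ((p1 e).1, e)).1 (p1 e).1 e.
  have /andP[_ /eqP[Fe pe]] := p1P e.
  case: j; first exact: Fa1.
  by rewrite [pick _ _ false]/= pe Fa1 -Fe -pe.
move=> i j []; first exact: Fab.
by rewrite [pick _ _ false]/= p0d p1d Fab -Fd -p0d -p1d.
Qed.

(** The summands are the least part sizes that [monochromatic_box] admits for k colours. They are at
    most 2k, 5k^3 and 100k^9 + 1, in total at most 108k^9; 128 is the next power of two. *)
Lemma box_size_bound k : 0 < k ->
  k.+1 + (k * k.+1 ^ 2).+1 + (k * k.+1 ^ 2 * (k * k.+1 ^ 2).+1 ^ 2).+1
    <= 2 ^ 7 * k ^ 9.
Proof.
move=> k0; set m0 := k.+1; set m1 := (k * m0 ^ 2).+1.
have kX i j : i <= j -> k ^ i <= k ^ j by apply: leq_pexp2l.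
have m0_le : m0 <= 2 * k by rewrite /m0; lia.
have m0X : m0 ^ 2 <= 4 * k ^ 2 by rewrite -(expnMn 2 k 2) leq_exp2r.
have m01 : k * m0 ^ 2 <= 4 * k ^ 3.
  by rewrite [k ^ 3]expnS mulnCA leq_mul2l m0X orbT.
have m1_le : m1 <= 5 * k ^ 3 by have := kX 0 3 isT; rewrite /m1; lia.
have m1X : m1 ^ 2 <= 25 * k ^ 6.
  by rewrite (expnM k 3 2) -(expnMn 5 (k ^ 3) 2) leq_exp2r.
have m2_le : k * m0 ^ 2 * m1 ^ 2 <= 100 * k ^ 9.
  by rewrite (expnD k 3 6) (mulnACA 4 25) leq_mul.
have := kX 0 9 isT; have := kX 1 9 isT; have := kX 3 9 isT.
rewrite expn0 expn1 (_ : 2 ^ 7 = 128) //; lia.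
Qed.

Lemma rounds_lower_bound (n N : nat) (A : congest_algorithm N 1 bool) :
  n <= N -> solves_triangle_membership n 2 A -> n < 2 ^ (7 + 81 * rounds A).
Proof.
move=> nN Asolves; rewrite ltnNge; apply/negP => n_large.
pose k := 2 ^ (9 * rounds A).
pose m0 := k.+1; pose m1 := (k * m0 ^ 2).+1.
pose m2 := (k * m0 ^ 2 * m1 ^ 2).+1.
have size : m0 + m1 + m2 <= n.
  apply: leq_trans n_large.
  rewrite expnD (_ : 81 * _ = 9 * rounds A * 9); last by lia.
  rewrite expnM -/k /m2 /m1 /m0.
  by apply: box_size_bound; rewrite expn_gt0.
(* The last summand pads the node set to exactly n; its nodes stay isolated. *)
pose V := ('I_m0 + 'I_m1 + 'I_m2 + 'I_(n - (m0 + m1 + m2)))%type.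
have Vn : #|{: V}| = n by rewrite !card_sum !card_ord subnKC.
have VN : #|{: V}| <= N by rewrite Vn.
pose id (v : V) : 'I_N := widen_ord VN (enum_rank v).
have idinj : injective id.
  by move=> u v /(congr1 val) /= /val_inj/enum_rank_inj.
pose place (a : 'I_m0) (b : 'I_m1) (d : 'I_m2) (i : 'Z_3) : V :=
  nth (inl (inl (inl a))) [:: inl (inl (inl a)); inl (inl (inr b)); inl (inr d)] i.
have cC : #|{: {ffun 'I_(rounds A) * 'Z_3 * 'Z_3 -> 1.-tuple bool}}| = k.
  rewrite card_ffun card_tuple card_bool !card_prod !card_ord expn1.
  by congr (_ ^ _); rewrite /= -mulnA mulnC.
have [|||a [b [d [c [ainj binj dinj box]]]]] :=
    @monochromatic_box _ _ _ _ (fun a b d => transcript A id (place a b d)).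
- by rewrite cC card_ord.
- by rewrite cC !card_ord.
- by rewrite cC !card_ord.
apply: (@transcript_not_constant _ _ _ _ A id
  (fun i s => place (a s) (b s) (d s) i) c Vn idinj Asolves) => [i j s s'|s]; last first.
  (* In ['Z_3] the element -1 is position 2. *)
  rewrite -(box (s 0%R) (s 1%R) (s (-1)%R)); congr transcript.
  apply: funext => i; case: i => [[|[|[|]]] // ip]; rewrite /place /=.
  - by congr (inl (inl (inl (a (s _))))); apply/val_inj.
  - by congr (inl (inl (inr (b (s _))))); apply/val_inj.
  - by congr (inl (inr (d (s _)))); apply/val_inj.
case: i => [[|[|[|]]] // ip]; case: j => [[|[|[|]]] // jp].
all: rewrite /place /= => -[] //.
- by move=> /ainj->; split=> //; apply/val_inj.
- by move=> /binj->; split=> //; apply/val_inj.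
- by move=> /dinj->; split=> //; apply/val_inj.
Qed.

Local Open Scope ring_scope.

(** * From the exponential bound to the iterated logarithm *)

Lemma log_star_min (R : realType) (x : R) k :
  iter k (@log2 R) x <= 1 -> (log_star x <= k)%N.
Proof. by move=> xk; rewrite /log_star; case: ex_minnP => m _; apply. Qed.

Lemma iter_log_star (R : realType) (x : R) :
  iter (log_star x) (@log2 R) x <= 1.
Proof. by rewrite /log_star; case: ex_minnP. Qed.

Lemma log_star_log2 (R : realType) (x : R) :
  (log_star x <= (log_star (log2 x)).+1)%N.
Proof. by apply: log_star_min; rewrite iterSr iter_log_star. Qed.

(** Each [log2] lowers an argument of at least 2 by at least 1. This crude linear bound suffices, as
    n is already at most exponential in the number of rounds. *)
Lemma log_star_le (R : realType) (x : R) m :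
  x <= m.+1%:R -> (log_star x <= m.+1)%N.
Proof.
elim: m x => [|m IHm] x xm; first exact: leq_trans (@log_star_min R x 0 xm) _.
have [x2|x2] := leP 2 x.
  apply: leq_trans (log_star_log2 x) _; rewrite ltnS; apply: IHm.
  by apply: le_trans (log2_le_sub1 x2) _; rewrite lerBlDr natr1.
have [x1|x1] := leP x 1; first exact: leq_trans (@log_star_min R x 0 x1) _.
apply: (@leq_trans 1) => //; apply: log_star_min; rewrite /= /log2.
rewrite ler_pdivrMr ?ln_gt0 ?ltr1n // mul1r.
by rewrite ler_ln ?posrE ?ltr0n ?ltW // (lt_trans _ x1).
Qed.

Lemma log_star_lt_exp2 (R : realType) (n k : nat) :
  (0 < n)%N -> (0 < k)%N -> (n < 2 ^ k)%N -> (log_star (n%:R : R) <= k.+1)%N.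
Proof.
move=> n0 k0 nk; apply: leq_trans (log_star_log2 _) _; rewrite ltnS.
case: k k0 nk => // k _ nk; apply: log_star_le.
have ln2 : 0 < ln (2 : R) by rewrite ln_gt0 ?ltr1n.
rewrite /log2 ler_pdivrMr // mulr_natl -lnXn ?ltr0n //.
by rewrite ler_ln ?posrE ?exprn_gt0 ?ltr0n // -natrX ler_nat ltnW.
Qed.

Theorem theorem3 (R : realType) (N : nat -> nat)
    (N_ge : forall n : nat, (n <= N n)%N) (N_poly : poly_bounded N) :
  exists (c : R) (n0 : nat), 0 < c /\
    forall n : nat, (n0 <= n)%N ->
      forall A : congest_algorithm (N n) 1 bool,
        solves_triangle_membership n 2 A ->
        c * (log_star (n%:R : R))%:R <= (rounds A)%:R.
Proof.
(* With r rounds, n < 2^(7 + 81r) gives log* n <= 81r + 8, which is at most 89r once r >= 1. For r =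
   0 it would give n < 2^7 = 128. *)
exists 89%:R^-1, 128%N; split; first by rewrite invr_gt0 ltr0n.
move=> n n128 A Asolves.
have nlt := rounds_lower_bound (N_ge n) Asolves.
have r0 : (0 < rounds A)%N.
  rewrite lt0n; apply: contraTneq nlt => ->; rewrite -leqNgt.
  exact: leq_trans n128.
rewrite mulrC ler_pdivrMr ?ltr0n // -natrM ler_nat.
apply: leq_trans (log_star_lt_exp2 R _ _ nlt) _; lia.
Qed.
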